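(* Let $d\ge 2$ and let $y_1,\ldots,y_n\in\mathbb{R}^d$ be in type $A$ general position. Then the number of cones in the Weyl tessellation $\mathcal{W}^A(y_1,\ldots,y_n)$ of type $A_{n-1}$ equals $$D^A(n,d):=2\left(\genfrac{[}{]}{0pt}{}{n}{n-d+1}+\genfrac{[}{]}{0pt}{}{n}{n-d+3}+\genfrac{[}{]}{0pt}{}{n}{n-d+5}+\cdots\right).$$
   Context: Type $A$ general position: vectors $y_1,\ldots,y_n\in\mathbb{R}^d$ are said to be in type $A$ general position if $n\ge d+1$ and, for every permutation $\sigma$ of $\{1,\ldots,n\}$, any $d$ of the vectors $y_{\sigma(1)}-y_{\sigma(2)},\,y_{\sigma(2)}-y_{\sigma(3)},\ldots,y_{\sigma(n-1)}-y_{\sigma(n)}$ are linearly independent. For $x\in\mathbb{R}^d\setminus\{0\}$ let $x^\perp=\{v\in\mathbb{R}^d:\langle v,x\rangle=0\}$. The Weyl tessellation $\mathcal{W}^A(y_1,\ldots,y_n)$ of type $A_{n-1}$ is the set of cones obtained as closures of the connected components of $\mathbb{R}^d\setminus\bigcup_{1\le i<j\le n}(y_i-y_j)^\perp$. The (unsigned) Stirling numbers of the first kind $\genfrac{[}{]}{0pt}{}{n}{k}$ are defined by $t(t+1)\cdots(t+n-1)=\sum_{k=1}^n\genfrac{[}{]}{0pt}{}{n}{k}t^k$, and $\genfrac{[}{]}{0pt}{}{n}{k}=0$ for $k\notin\{1,\ldots,n\}$. *)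

(* Defs.v *)
From HB Require Import structures.
From mathcomp Require Import all_boot all_order all_fingroup all_algebra.
From mathcomp Require Import all_classical all_reals all_analysis.

Set Implicit Arguments.
Unset Strict Implicit.
Unset Printing Implicit Defensive.

Import Order.TTheory GRing.Theory Num.Theory.
Import numFieldNormedType.Exports.

Local Open Scope classical_set_scope.
Local Open Scope ring_scope.

Lemma ord_next_subproof n (k : 'I_n.-1) : (k.+1 < n)%N.
Proof. by rewrite -ltn_predRL. Qed.

Definition ord_here n (k : 'I_n.-1) : 'I_n := widen_ord (leq_pred n) k.

(* Unlike ordS, there is no wrap-around: k ranges over 0, ..., n - 2. *)
Definition ord_next n (k : 'I_n.-1) : 'I_n := Ordinal (ord_next_subproof k).

Definition typeA_general_position (R : realType) (n d : nat)
    (y : 'I_n -> 'rV[R]_d) : Prop :=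
  (d.+1 <= n)%N /\
  forall (s : 'S_n) (S : {set 'I_n.-1}), #|S| = d ->
    free [seq y (s (ord_here k)) - y (s (ord_next k)) | k <- enum S].

Definition inner (R : realType) (d : nat) (u v : 'rV[R]_d) : R :=
  \sum_(i < d) u 0 i * v 0 i.

Definition orth (R : realType) (d : nat) (x : 'rV[R]_d) : set 'rV[R]_d :=
  [set v | inner v x = 0].

Definition connected_components (T : topologicalType) (A : set T) :
    set (set T) :=
  [set connected_component A x | x in A].

Definition weylA_complement (R : realType) (n d : nat)
    (y : 'I_n -> 'rV[R]_d) : set 'rV[R]_d :=
  ~` \bigcup_(p in [set p : 'I_n * 'I_n | (p.1 < p.2)%N])
       orth (y p.1 - y p.2).

Definition weyl_tessellationA (R : realType) (n d : nat)
    (y : 'I_n -> 'rV[R]_d) : set (set 'rV[R]_d) :=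
  [set closure C | C in connected_components (weylA_complement y)].

Definition stirling1 (n k : nat) : nat :=
  if (1 <= k <= n)%N then (\prod_(i < n) ('X + i%:R%:P) : {poly nat})`_k
  else 0%N.

(* For d <= n the terms with j >= d have lower index > n, hence vanish, so this
   finite sum is the whole series; also n.+1 - d is then not truncated. *)
Definition DA (n d : nat) : nat :=
  (2 * \sum_(j < d) stirling1 n (n.+1 - d + j.*2))%N.

(* Main.v *)
Require Import Defs.
From HB Require Import structures.
From mathcomp Require Import all_boot all_order all_fingroup all_algebra.
From mathcomp Require Import all_classical all_reals all_analysis.
From mathcomp Require Import zify.

(** The cones of the tessellation are the closures of the cells of the
arrangement of the hyperplanes orthogonal to the [y i - y j], and a cell is
determined by its sign pattern: cells are convex, so they are the connected
components of the complement, and they are open, so they are recovered from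
their closures ([card_cells_closure]). It remains to count the realizable sign
patterns.

Consider the linear forms [z_i = inner v (y i)] on a subspace [U] of dimension
[k] on which some of them have been forced to be equal, and let [c m k] be the
number of cells cut out by the walls between [m.+1] of the resulting classes.
Remove one of these classes, [x]. Adding the walls between [x] and the others
one by one, each wall cuts exactly the cells that it meets ([cells_delres]); on
the wall [z_x = z_i] the other walls of [x] coincide with walls of [i], so the
number of new cells is the number of cells of the remaining classes on the
slice of [U] where [x] and [i] are glued ([cells_insert]). Hence
[c m.+1 k.+1 = c m k.+1 + m.+1 * c m k], with [c 0 k = 1] and
[c m.+1 0 = 0] ([cells_count]).

This needs every gluing in positive dimension to drop the dimension by exactly
one, that is, no unwanted coincidences between the forms on [U]. General
position gives this ([separating_vector]): a coincidence would be an affine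
dependence between the [y i], supported on few blocks of indices, and
reordering the indices block by block and summing by parts makes it a
dependence between at most [d] consecutive differences
([affine_dependence_trivial]).

Indexed by codimension, Stirling numbers satisfy the same recurrence, and so do
their sums over indices of one parity, whose doubles start with the right
values for two points ([chamber_countE]). *)

Set Implicit Arguments.
Unset Strict Implicit.
Unset Printing Implicit Defensive.

Import Order.TTheory GRing.Theory Num.Theory.
Import numFieldNormedType.Exports.

Local Open Scope ring_scope.

(** * Sign patterns, deletion and restriction *)

Section Inner.
Variables (R : realType) (d : nat).
Implicit Types u v w l : 'rV[R]_d.

Lemma innerE v l : inner v l = (v *m l^T) 0 0.
Proof. by rewrite mxE; apply: eq_bigr => i _; rewrite mxE. Qed.

Lemma innerDl u v l : inner (u + v) l = inner u l + inner v l.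
Proof. by rewrite !innerE mulmxDl mxE. Qed.

Lemma innerZl a v l : inner (a *: v) l = a * inner v l.
Proof. by rewrite !innerE -scalemxAl mxE. Qed.

Lemma innerBr v l l' : inner v (l - l') = inner v l - inner v l'.
Proof. by rewrite !innerE linearB mulmxBr !mxE. Qed.

Lemma innerNr v l : inner v (- l) = - inner v l.
Proof. by rewrite !innerE linearN mulmxN mxE. Qed.

Lemma mul_tr_eq0 v l : (v *m l^T == 0) = (inner v l == 0).
Proof.
rewrite innerE; apply/eqP/eqP => [->|h]; first by rewrite mxE.
by apply/matrixP => i j; rewrite !ord1 h mxE.
Qed.
End Inner.

Section Patterns.
Variables (R : realType) (d : nat).
Implicit Types (u v w l : 'rV[R]_d) (L K : seq 'rV[R]_d) (U : 'M[R]_d).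

(** A list [L] of vectors stands for the hyperplanes orthogonal to them, a
subspace [U] for the row space of a matrix. Inside [U], the cells of the
arrangement are encoded by their sign patterns along [L]. *)
Definition off_walls L v := all (fun l => inner v l != 0) L.
Definition pattern L v : seq bool := [seq 0 < inner v l | l <- L].

Fixpoint bitseqs m : seq bitseq :=
  if m is m'.+1 then
    [seq true :: s | s <- bitseqs m'] ++ [seq false :: s | s <- bitseqs m']
  else [:: [::]].

Lemma bitseqs_uniq m : uniq (bitseqs m).
Proof.
elim: m => //= m IH.
rewrite cat_uniq !map_inj_uniq ?IH //=; try by move=> ? ? [].
by rewrite andbT -all_predC; apply/allP => _ /mapP[s _ ->]; apply/mapP => -[].
Qed.

Lemma mem_bitseqs s : s \in bitseqs (size s).
Proof.
by elim: s => //= -[] s IH; rewrite mem_cat map_f ?orbT.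
Qed.

Definition realizes U L s : Prop :=
  exists v, [/\ (v <= U)%MS, off_walls L v & pattern L v = s].

Definition cells U L : seq bitseq :=
  [seq s <- bitseqs (size L) | `[< realizes U L s >]].

Lemma cells_uniq U L : uniq (cells U L).
Proof. exact/filter_uniq/bitseqs_uniq. Qed.

Lemma mem_cells U L s : (s \in cells U L) = `[< realizes U L s >].
Proof.
rewrite mem_filter andb_idr // => /asboolP[v [_ _ <-]].
by have := mem_bitseqs (pattern L v); rewrite size_map.
Qed.

(** Finitely many strict inequalities survive a small perturbation. The bound
is on the absolute value of [t], so a point can be moved to either side of a
further hyperplane without leaving its cell. *)
Lemma stable_pattern L v u : off_walls L v ->
  exists2 e : R, 0 < e & forall t, `|t| <= e ->
    off_walls L (v + t *: u) /\ pattern L (v + t *: u) = pattern L v.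
Proof.
elim: L => [|l L IH] /=; first by exists 1.
case/andP=> vl /IH[e e0 he].
pose a := `|inner v l|; pose b := `|inner u l| + 1.
have a0 : 0 < a by rewrite normr_gt0.
have b0 : 0 < b by rewrite ltr_pwDr.
(* Adding 1 keeps b positive when l vanishes on u; halving makes the bound
   on |t * inner u l| strict. *)
exists (Num.min e (a / b / 2%:R)).
  by rewrite lt_min e0 !divr_gt0.
move=> t; rewrite le_min => /andP[te tab].
have [-> ->] := he _ te.
have lt_a : `|t * inner u l| < a.
  rewrite normrM; apply: (@le_lt_trans _ _ (`|t| * b)).
    by rewrite ler_wpM2l // lerDl.
  apply: (@le_lt_trans _ _ (a / b / 2%:R * b)).
    by rewrite ler_wpM2r // ltW.
  rewrite mulrAC divfK ?gt_eqF// ltr_pdivrMr // ltr_pMr // ltr1n //.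
have -> : (0 < inner (v + t *: u) l) = (0 < inner v l).
  rewrite innerDl innerZl; move: lt_a; rewrite /a ltr_norml => /andP[].
  case: (ltgtP (inner v l) 0) => [h|h|h]; last by rewrite h eqxx in vl.
    rewrite ltr0_norm // => h1 h2; apply/negbTE; rewrite -leNgt.
    by rewrite -(subrr (inner v l)) lerD2l ltW.
  rewrite gtr0_norm // => h1 h2.
  by rewrite -(subrr (inner v l)) ltrD2l.
split => //; rewrite andbT innerDl innerZl addr_eq0.
by apply/eqP => h; move: lt_a; rewrite -normrN -h ltxx.
Qed.

(** Cells are convex cones: being strictly positive, or strictly negative,
on a vector is preserved by nonnegative combinations that are not both
zero. *)
Lemma pattern_cone L v w (a b : R) : off_walls L v -> off_walls L w ->
  pattern L v = pattern L w -> 0 <= a -> 0 <= b -> 0 < a + b ->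
  off_walls L (a *: v + b *: w) /\ pattern L (a *: v + b *: w) = pattern L v.
Proof.
move=> + + + a0 b0 ab0.
elim: L => //= l L IH /andP[vl vL] /andP[wl wL] [e /(IH vL wL)[-> ->]].
rewrite innerDl !innerZl andbT.
have ab : (0 < a) || (0 < b).
  rewrite !lt0r a0 b0 !andbT -negb_and; apply/negP => /andP[/eqP h /eqP h'].
  by rewrite h h' addr0 ltxx in ab0.
case: (ltgtP (inner v l) 0) => [h|h|h]; last by rewrite h eqxx in vl.
- have h' : inner w l < 0 by rewrite lt_neqAle wl leNgt -e -leNgt ltW.
  suff h'' : a * inner v l + b * inner w l < 0 by rewrite lt_eqF // ltNge ltW.
  case/orP: ab => c.
    by rewrite ltr_wnDr ?nmulr_llt0 // mulr_ge0_le0 // ltW.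
  by rewrite ltr_wnDl ?nmulr_llt0 // mulr_ge0_le0 // ltW.
- have h' : 0 < inner w l by rewrite -e.
  suff h'' : 0 < a * inner v l + b * inner w l by rewrite gt_eqF // h''.
  case/orP: ab => c.
    by rewrite ltr_wpDr ?mulr_gt0 // mulr_ge0 // ltW.
  by rewrite ltr_wpDl ?mulr_gt0 // mulr_ge0 // ltW.
Qed.

Definition slice U l : 'M[R]_d := (U :&: kermx l^T)%MS.

Lemma sub_slice U l v : (v <= slice U l)%MS = (v <= U)%MS && (inner v l == 0).
Proof. by rewrite sub_capmx (sameP sub_kermxP eqP) mul_tr_eq0. Qed.

Lemma rank_slice U l : (exists2 u, (u <= U)%MS & inner u l != 0) ->
  \rank U = (\rank (slice U l)).+1.
Proof.
case=> u uU ul; rewrite -(mxrank_mul_ker U l^T) -[RHS]add1n; congr (_ + _)%N.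
apply/eqP; rewrite eqn_leq rank_leq_col lt0n mxrank_eq0.
apply: contra ul => /eqP h; rewrite -mul_tr_eq0.
by case/submxP: uU => D ->; rewrite -mulmxA h mulmx0.
Qed.

(** Deletion and restriction. A cell of [L] survives on at least one side of
the new hyperplane, by perturbing a point along [u] if needed. It survives on
both sides exactly when the hyperplane cuts it: a convex combination of points
on the two sides lies on the hyperplane, and conversely a point of the
hyperplane can be pushed to either side. Summing over the cells of [L], the
cells of [l :: L] are counted by inclusion-exclusion. *)
Lemma cells_delres U l L :
  (exists2 u, (u <= U)%MS & inner u l != 0) ->
  size (cells U (l :: L)) = (size (cells U L) + size (cells (slice U l) L))%N.
Proof.
case=> u uU ul.
wlog ul0 : u uU ul / 0 < inner u l.
  move=> hw; case: (ltgtP (inner u l) 0) => [h|h|h]; 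
    last by rewrite h eqxx in ul.
    have e : inner (- 1 *: u) l = - inner u l by rewrite innerZl mulN1r.
    by apply: (hw (- 1 *: u)); rewrite ?scalemx_sub ?e ?oppr_eq0 ?oppr_gt0.
  exact: (hw u).
pose P1 s := `[< realizes U (l :: L) (true :: s) >].
pose P0 s := `[< realizes U (l :: L) (false :: s) >].
have union s : `[< realizes U L s >] = predU P1 P0 s.
  apply/asboolP/orP;
    last by case=> /asboolP[v [vU /andP[_ vL] [_ vs]]]; exists v.
  case=> v [vU vL vs].
  have [vl|vl] := eqVneq (inner v l) 0; last first.
    case: (boolP (0 < inner v l)) => h; [left|right]; apply/asboolP; exists v.
      by rewrite /= vU vl vL vs h.
    by rewrite /= vU vl vL vs (negbTE h).
  have [e e0 /(_ e)[|h1 h2]] := stable_pattern u vL.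
    by rewrite gtr0_norm.
  have pe : 0 < inner (v + e *: u) l.
    by rewrite innerDl innerZl vl add0r mulr_gt0.
  left; apply/asboolP; exists (v + e *: u).
  by rewrite /= addmx_sub ?scalemx_sub // h1 h2 vs pe gt_eqF.
have inter s : `[< realizes (slice U l) L s >] = predI P1 P0 s.
  apply/asboolP/andP;
    last case=> /asboolP[v [vU /andP[vl vL] [vl0 vs]]].
    case=> v [vU vL vs].
    move: vU; rewrite sub_slice => /andP[vU /eqP vl].
    have [e e0 he] := stable_pattern u vL.
    have hpm (t : R) : `|t| <= e -> t != 0 ->
        realizes U (l :: L) ((0 < t) :: s).
      move=> te t0; have [h1 h2] := he _ te; exists (v + t *: u).
      rewrite /= addmx_sub ?scalemx_sub // h1 h2 vs innerDl innerZl vl add0r.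
      by rewrite mulf_neq0 // pmulr_lgt0.
    split; apply/asboolP.
      by have := hpm e; rewrite e0; apply; rewrite ?gt_eqF // gtr0_norm.
    have := hpm (- e); rewrite oppr_gt0 ltNge (ltW e0); apply.
      by rewrite normrN gtr0_norm.
    by rewrite oppr_eq0 gt_eqF.
  case/asboolP=> w [wU /andP[wl wL] [wl0 ws]].
  have wn : inner w l < 0 by rewrite lt_neqAle wl leNgt wl0.
  (* The positive weights for which the values of l at v and w cancel. *)
  exists ((- inner w l) *: v + inner v l *: w).
  have [||| h1 h2] :=
    @pattern_cone L v w (- inner w l) (inner v l) vL wL _ _ (ltW vl0).
  - by rewrite vs ws.
  - by rewrite oppr_ge0 ltW.
  - by rewrite addr_gt0 // oppr_gt0.
  split=> //; last by rewrite h2.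
  rewrite sub_slice addmx_sub ?scalemx_sub // innerDl !innerZl.
  by rewrite mulNr mulrC addNr eqxx.
rewrite /cells /= !size_filter count_cat !count_map.
rewrite (eq_count union) (eq_count inter) count_predUI.
by congr addn; apply: eq_count.
Qed.
(** Walls that agree on [U] with walls already present cut nothing: their
sign is read off an existing position of the pattern. *)
Lemma cells_redundant U K L :
  (forall l, l \in K -> exists2 l', l' \in L &
     forall v, (v <= U)%MS -> inner v l = inner v l') ->
  size (cells U (K ++ L)) = size (cells U L).
Proof.
elim: K => // l K IH h.
rewrite -IH => [|l' l'K]; last by apply: h; rewrite in_cons l'K orbT.
have [l' l'L ll'] := h l (mem_head l K).
pose i := index l' (K ++ L).
have l'KL : l' \in K ++ L by rewrite mem_cat l'L orbT.
have bit v : (v <= U)%MS -> (0 < inner v l) = nth false (pattern (K ++ L) v) i.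
  by move=> vU; rewrite ll' // (nth_map 0) ?index_mem // nth_index.
have off v : (v <= U)%MS -> off_walls (K ++ L) v -> off_walls (l :: K ++ L) v.
  by move=> vU /[dup] /allP/(_ _ l'KL) h1 h2; rewrite /= h2 ll' // h1.
rewrite -(size_map (fun s : bitseq => nth false s i :: s) (cells U (K ++ L))).
apply: perm_size; apply: uniq_perm; rewrite ?map_inj_uniq ?cells_uniq //.
  by move=> s t [].
move=> s; rewrite mem_cells.
apply/asboolP/mapP => [[v [vU /andP[vl vL] <-]]|[t + ->]].
  exists (pattern (K ++ L) v); last by rewrite -bit.
  by rewrite mem_cells; apply/asboolP; exists v.
rewrite mem_cells => /asboolP[v [vU vL <-]].
exists v; split=> //; first exact: off.
by rewrite -bit.
Qed.
End Patterns.

(** * Affine dependences in general position *)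

Section GP.
Variables (R : realType).

Lemma summation_by_parts (V : lmodType R) (a : nat -> R) (z : nat -> V) m :
  \sum_(i < m.+1) a i *: z i =
  \sum_(k < m) (\sum_(i < k.+1) a i) *: (z k - z k.+1) +
  (\sum_(i < m.+1) a i) *: z m.
Proof.
elim: m => [|m IH]; first by rewrite !big_ord1 big_ord0 add0r.
rewrite big_ord_recr /= IH [in RHS]big_ord_recr /= -!addrA; congr (_ + _).
rewrite scalerBr [\sum_(i < m.+2) a i]big_ord_recr /= scalerDl addrA subrK //.
Qed.

Lemma free_map_coef (I : finType) (V : vectType R) (S : {set I}) (g : I -> V)
    (c : I -> R) :
  free [seq g k | k <- enum S] -> \sum_(k in S) c k *: g k = 0 ->
  forall k, k \in S -> c k = 0.
Proof.
move=> fr s0 k kS.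
have /freeP h : free (in_tuple [seq g k | k <- enum S]) := fr.
have lt_k : (index k (enum S) < size [seq g k | k <- enum S])%N.
  by rewrite size_map index_mem mem_enum.
have := h (fun i => c (nth k (enum S) i)) _ (Ordinal lt_k).
rewrite /= nth_index ?mem_enum //; apply.
rewrite -[RHS]s0 -[RHS]big_enum /= [RHS](big_nth k) big_mkord size_map.
by apply: eq_bigr => i _; rewrite (nth_map k) // -(size_map g).
Qed.

Lemma sorting_perm n (f : 'I_n -> nat) :
  exists s : 'S_n, forall i j : 'I_n, (i <= j)%N -> (f (s i) <= f (s j))%N.
Proof.
pose t := sort (relpre f leq) (enum 'I_n).
have st : size t == n by rewrite size_sort size_enum_ord.
pose g (i : 'I_n) := tnth (Tuple st) i.
have gi : injective g.
  by apply/tuple_uniqP; rewrite /= sort_uniq enum_uniq.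
exists (perm gi) => i j ij; rewrite !permE /g !(tnth_nth i) /=.
apply: (@sorted_leq_nth _ (relpre f leq)) => //.
- by move=> ? ? ? /=; apply: leq_trans.
- by move=> ? /=.
- by apply: sort_sorted => ? ? /=; apply: leq_total.
- by rewrite inE (eqP st).
- by rewrite inE (eqP st).
Qed.

(** Used to complete a small family of consecutive differences to one of the
exact size for which general position asserts linear independence. *)
Lemma set_extension (T : finType) (A : {set T}) m :
  (#|A| <= m)%N -> (m <= #|T|)%N -> exists2 B : {set T}, A \subset B & #|B| = m.
Proof.
move=> Am mT; move: Am; elim: m mT => [|m IH] mT.
  by rewrite leqn0 => /eqP h; exists A.
rewrite leq_eqVlt => /orP[/eqP h|Am]; first by exists A.
have [B AB Bm] := IH (ltnW mT) Am.
have /card_gt0P[x] : (0 < #|~: B|)%N by rewrite -(cardsC B) in mT; lia.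
rewrite inE => xB; exists (x |: B); first by rewrite subsetU // AB orbT.
by rewrite cardsU1 xB Bm.
Qed.

Lemma block_sums (I : finType) (f : I -> I) (w : I -> R) (P : pred I) :
  (forall l, \sum_(x | f x == l) w x = 0) -> \sum_(x | P (f x)) w x = 0.
Proof.
move=> h; rewrite (partition_big f P) //=; apply: big1 => l Pl.
rewrite -[RHS](h l); apply: eq_bigl => x.
by case: eqP => [->|]; rewrite ?Pl ?andbF.
Qed.

(** The form in which general position is used: an affine dependence that
balances on every block of a partition into at least [n - d] blocks (the
fibres of [f]) is trivial. Ordering the indices block by block and summing by
parts turns it into a linear relation between consecutive differences whose
coefficients are the partial sums of [w]; the partial sums vanish at the end
of each block, so at most [d] differences remain, and these are linearly
independent. *)
Lemma affine_dependence_trivial n d (y : 'I_n -> 'rV[R]_d) (f : 'I_n -> 'I_n)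
    (w : 'I_n -> R) :
  typeA_general_position y -> (n <= #|codom f| + d)%N ->
  (forall l, \sum_(x | f x == l) w x = 0) ->
  \sum_x w x *: y x = 0 -> forall x, w x = 0.
Proof.
case: n y f w => [|n] y f w; first by move=> _ _ _ _ [].
move=> [dn gp] cd bs ws.
have [s ss] := sorting_perm (fun x => f x).
pose a i := w (s (inord i)).
pose z i := y (s (inord i)).
pose W k := \sum_(i < k.+1) a i.
have aE (i : 'I_n.+1) : a i = w (s i) by rewrite /a inord_val.
have hereE (k : 'I_n) : ord_here (k : 'I_n.+1.-1) = inord k.
  by apply: val_inj; rewrite /= inordK // ltnS ltnW.
have nextE (k : 'I_n) : ord_next (k : 'I_n.+1.-1) = inord k.+1.
  by apply: val_inj; rewrite /= inordK // ltnS.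
have Wn : W n = 0.
  rewrite /W (eq_bigr (fun i => w (s i))) //.
  by have := block_sums predT bs; rewrite (reindex_perm s).
(* The positions where one block ends and the next one begins. *)
pose E := [set k : 'I_n | f (s (inord k)) != f (s (inord k.+1))].
have WE k : k \in E -> W k = 0.
  rewrite inE => kE.
  have lt_f : (f (s (inord k)) < f (s (inord k.+1)))%N.
    by rewrite ltn_neqAle kE ss // !inordK // ltnS // ltnW.
  rewrite /W (big_ord_widen n.+1 a) ?ltnS // 1?ltnW //.
  have := block_sums (fun l : 'I_n.+1 => (l <= f (s (inord k)))%N) bs.
  rewrite (reindex_perm s) /= => h; rewrite -[RHS]h {h}.
  apply: eq_big => [i|i _]; last exact: aE.
  rewrite ltnS; apply/idP/idP => h.
    by apply: ss; rewrite inordK // ltnS ltnW.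
  rewrite leqNgt; apply/negP => h'.
  suff : (f (s (inord k.+1)) <= f (s i))%N by lia.
  by apply: ss; rewrite inordK // ltnS.
have cE : (#|codom f| <= #|E|.+1)%N.
  pose F := f (s ord0) |: [set f (s (inord k.+1)) | k : 'I_n in E].
  apply: (@leq_trans #|F|); last first.
    by rewrite cardsU1 (leq_add (leq_b1 _)) // leq_imset_card.
  apply: subset_leq_card; apply/fintype.subsetP => _ /codomP[x ->].
  rewrite -(permKV s x); case: (s^-1 x)%g => i; elim: i => [|i IH] lti.
    by rewrite (_ : Ordinal lti = ord0) ?setU11 //; apply: val_inj.
  have lti' := ltn_trans (ltnSn i) lti.
  have := IH lti'.
  have -> : Ordinal lti' = inord i by apply: val_inj; rewrite /= inordK.
  have -> : Ordinal lti = inord i.+1 by apply: val_inj; rewrite /= inordK.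
  have lein : (i < n)%N by [].
  case: (boolP (Ordinal lein \in E)) => [iE _|].
    by apply/setU1P; right; apply/imsetP; exists (Ordinal lein).
  by rewrite inE negbK /= => /eqP ->.
have [S NS cS] : exists2 S : {set 'I_n}, ~: E \subset S & #|S| = d.
  apply: set_extension; last by rewrite card_ord.
  rewrite cardsCs finset.setCK card_ord leq_subLR.
  exact: (leq_trans cd (leq_add cE (leqnn d))).
have fr := gp s S cS.
have W0 k : (k <= n)%N -> W k = 0.
  rewrite leq_eqVlt => /orP[/eqP-> //|kn].
  case: (boolP (Ordinal kn \in S)) => [kS|kS]; last first.
    apply: (WE (Ordinal kn)); apply: contraR kS => h.
    apply: (fintype.subsetP NS).
    by rewrite inE.
  suff sum0 : \sum_(k in S) W k *:
      (y (s (ord_here (k : 'I_n.+1.-1))) - y (s (ord_next (k : 'I_n.+1.-1))))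
      = 0.
    exact: (free_map_coef fr sum0 kS).
  have := summation_by_parts a z n; rewrite -/(W n) Wn scale0r addr0.
  rewrite (eq_bigr (fun i => w (s i) *: y (s i))); last first.
    by move=> i _; rewrite aE /z inord_val.
  move: ws; rewrite (reindex_perm s) /= => ->.
  move=> h; rewrite [RHS]h [RHS](bigID (mem S)) /= [X in _ + X]big1 ?addr0.
    by apply: eq_bigr => i _; rewrite hereE nextE.
  move=> i iS; rewrite -/(W i) WE ?scale0r //.
  by apply: contraR iS => h'; apply: (fintype.subsetP NS); rewrite inE.
move=> x; rewrite -(permKV s x); move: (s^-1 x)%g => i; rewrite -aE.
case: i => -[|i] lti /=; first by have := W0 0 isT; rewrite /W big_ord1.
by have := W0 i.+1 lti; rewrite /W big_ord_recr /= -/(W i) W0 ?add0r // ltnW.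
Qed.
End GP.

(** * Counting cells by gluing indices *)

(** The number of cells cut out by [m.+1] points in dimension [k]; without a
wall the whole space is one cell, whatever its dimension. *)
Fixpoint chamber_count m k : nat :=
  if m is m'.+1 then
    if k is k'.+1 then (chamber_count m' k + m * chamber_count m' k')%N else 0%N
  else 1%N.

Section Count.
Variables (R : realType) (n d : nat) (y : 'I_n -> 'rV[R]_d).

(** Each pair is listed once, with the pairs of the head before those of the
tail, so that the walls of the head can be added to the arrangement of the
tail. The orientation follows the order in the list. *)
Fixpoint edges (s : seq 'I_n) : seq ('I_n * 'I_n) :=
  if s is x :: s' then [seq (x, z) | z <- s'] ++ edges s' else [::].

Definition walls (E : seq ('I_n * 'I_n)) := [seq y p.1 - y p.2 | p <- E].

(** A map [f] sends every index to the representative of its class; on [U]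
the linear forms defined by [y] take the same values along each class, and [U]
is the largest such subspace. It is the flat of the arrangement attached to
the partition into classes. *)
Definition glued (f : 'I_n -> 'I_n) (U : 'M[R]_d) :=
  forall v, (v <= U)%MS <-> forall x, inner v (y x) = inner v (y (f x)).

Definition glue (f : 'I_n -> 'I_n) a b x := if f x == a then b else f x.

Lemma glued_glue f U a b : glued f U -> f a = a -> f b = b ->
  glued (glue f a b) (slice U (y a - y b)).
Proof.
move=> gU fa fb v; rewrite sub_slice innerBr subr_eq0 /glue; split.
  case/andP=> /gU vU /eqP ab x; by rewrite vU; case: eqP => // ->.
move=> h.
have ab : inner v (y a) = inner v (y b) by rewrite (h a) fa eqxx.
rewrite ab eqxx andbT; apply/gU => x; rewrite (h x); case: eqP => // ->.
by rewrite ab.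
Qed.

(** Pointwise form of idempotence: [f] fixes its representatives, so its
codomain counts the classes. *)
Definition idem (f : 'I_n -> 'I_n) := forall x, f (f x) = f x.

Lemma glue_idem f a b : idem f -> f b = b -> a != b -> idem (glue f a b).
Proof.
move=> ff fb ab x; rewrite /glue; case: (eqVneq (f x) a) => [_|h].
  by rewrite fb eq_sym (negbTE ab).
by rewrite ff (negbTE h).
Qed.

Lemma card_codom_glue f a b : idem f -> f a = a -> f b = b -> a != b ->
  #|codom f| = #|codom (glue f a b)|.+1.
Proof.
move=> ff fa fb ab.
have h x : (x \in codom (glue f a b)) = (x != a) && (x \in codom f).
  apply/codomP/andP => [[z ->]|[xa /codomP[z xz]]].
    rewrite /glue; case: (eqVneq (f z) a) => [_|h]; last by rewrite codom_f.
    by rewrite eq_sym ab -fb codom_f.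
  by exists z; rewrite /glue -xz (negbTE xa).
rewrite (cardD1 a) -{1}fa codom_f add1n; congr S.
by apply: eq_card => x; rewrite h !inE.
Qed.

(** As long as more than [n - d] classes remain, two of them are not glued
accidentally. Otherwise [y a - y b] lies in the span of the differences
[y x - y (f x)], by duality with the orthogonal complement [U]. This is an
affine dependence [w] which balances on the classes of [glue f a b], hence it
is trivial; but its sum over the class of [a] alone is 1. *)
Lemma separating_vector f U a b : typeA_general_position y ->
  (n < #|codom f| + d)%N -> idem f -> glued f U ->
  f a = a -> f b = b -> a != b ->
  exists2 u, (u <= U)%MS & inner u (y a - y b) != 0.
Proof.
move=> gp nd ff gU fa fb ab; apply: contrapT => hno.
have hU u : (u <= U)%MS -> inner u (y a - y b) = 0.
  by move=> uU; apply/eqP; apply: contrapT => /negP h; apply: hno; exists u.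
pose A : 'M[R]_(n, d) := \matrix_x (y x - y (f x)).
have : (y a - y b <= A)%MS.
  rewrite submxE; apply/eqP/matrixP => i j; rewrite ord1 {i} [RHS]mxE.
  pose v := (col j (cokermx A))^T.
  have -> : ((y a - y b) *m cokermx A) 0 j = inner v (y a - y b).
    by rewrite mxE; apply: eq_bigr => i _; rewrite !mxE mulrC.
  apply: hU; apply/gU => x; apply/eqP; rewrite -subr_eq0 -innerBr.
  have /matrixP/(_ x j) := mulmx_coker A; rewrite [RHS]mxE => h; rewrite -h.
  by apply/eqP; rewrite mxE; apply: eq_bigr => i _; rewrite !mxE mulrC.
case/submxP=> D eD.
pose w x : R := (x == a)%:R - (x == b)%:R - (D 0 x - \sum_(z | f z == x) D 0 z).
have delta (V : lmodType R) (g : 'I_n -> V) c :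
    \sum_x ((x == c)%:R : R) *: g x = g c.
  rewrite (bigD1 c) //= eqxx scale1r big1 ?addr0 // => x /negbTE ->.
  exact: scale0r.
(* Testing w against arbitrary values g gives both the dependence between the
   y x and, with indicator functions, the sums over blocks. *)
have wg (V : lmodType R) (g : 'I_n -> V) :
    \sum_x w x *: g x = g a - g b - \sum_x D 0 x *: (g x - g (f x)).
  rewrite /w.
  under eq_bigr do rewrite !scalerBl.
  rewrite !sumrB !delta; congr (_ - _).
  under [RHS]eq_bigr do rewrite scalerBr.
  rewrite sumrB; congr (_ - _).
  rewrite [RHS](partition_big f predT) //=; apply: eq_bigr => x _.
  by rewrite scaler_suml; apply: eq_bigr => z /eqP ->.
have block (P : pred 'I_n) : (forall x, P (f x) = P x) ->
    \sum_(x | P x) w x = (P a)%:R - (P b)%:R.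
  move=> hP; have := wg R^o (fun x => (P x)%:R).
  rewrite [in RHS](eq_bigr (fun=> 0)) => [|x _]; last first.
    by rewrite hP subrr scaler0.
  rewrite big1_eq subr0 => <-; rewrite big_mkcond; apply: eq_bigr => x _.
  by case: (P x); rewrite /GRing.scale /= ?mulr1 ?mulr0.
have w0 : forall x, w x = 0.
  apply: (affine_dependence_trivial (f := glue f a b) gp).
  - by move: nd; rewrite (card_codom_glue ff fa fb ab).
  - move=> l; rewrite block /glue ?fa ?fb; last by move=> x; rewrite ff.
    by rewrite eqxx [b == a]eq_sym (negbTE ab) subrr.
  - rewrite wg eD mulmx_sum_row; apply/eqP; rewrite subr_eq0; apply/eqP.
    by apply: eq_bigr => x _; rewrite rowK.
have := block (fun x => f x == a) (fun x => congr1 (eq_op^~ a) (ff x)).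
rewrite fa fb eqxx [b == a]eq_sym (negbTE ab) subr0.
rewrite big1 => [/eqP|x _]; last exact: w0.
by rewrite eq_sym oner_eq0.
Qed.

(** Adding the walls between [x] and the indices in [s], one at a time, to the
arrangement of [t]. On the slice where [x] and [z] agree, each remaining wall
between [x] and [z'] coincides with the wall between [z] and [z'], which is
already there. *)
Lemma cells_insert U x s t :
  (forall z, z \in s -> exists2 u, (u <= U)%MS & inner u (y x - y z) != 0) ->
  subseq s t ->
  size (cells U (walls ([seq (x, z) | z <- s] ++ edges t))) =
  (size (cells U (walls (edges t))) +
   \sum_(z <- s) size (cells (slice U (y x - y z)) (walls (edges t))))%N.
Proof.
elim: s => [|z s IH] hs sst; first by rewrite big_nil addn0.
have sst' : subseq s t by apply: subseq_trans sst; exact: subseq_cons.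
rewrite /= cells_delres; last by apply: hs; exact: mem_head.
rewrite big_cons -/(walls _) IH //; last first.
  by move=> z' z's; apply: hs; rewrite in_cons z's orbT.
rewrite addnAC addnA; congr (_ + _ + _)%N.
rewrite /walls map_cat cells_redundant // => _ /mapP[_ /mapP[z' z's ->] ->] /=.
exists (y z - y z').
  apply/mapP; exists (z, z') => //.
  elim: t {IH hs sst'} sst => // a t IHt /=.
  case: eqP => [-> |_] h; rewrite mem_cat.
    by rewrite map_f // (mem_subseq h).
  by rewrite IHt ?orbT.
move=> v; rewrite sub_slice !innerBr subr_eq0 => /andP[_ /eqP ->] //.
Qed.

(** The cells on a [k]-dimensional flat [U] cut out by the walls between
unglued indices. Inserting [x] either leaves the flat unchanged or glues [x]
to one of the other indices, and then the dimension drops by one. A flat of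
dimension 0 has no cell as soon as there is a wall. *)
Lemma cells_count s x f U k : typeA_general_position y -> uniq (x :: s) ->
  idem f -> {in x :: s, f =1 id} -> glued f U ->
  (#|codom f| + d = n + k)%N -> \rank U = k ->
  size (cells U (walls (edges (x :: s)))) = chamber_count (size s) k.
Proof.
move=> gp; elim: s x f U k => [|x' s IH] x f U k.
  move=> _ _ _ _ _ _ /=.
  rewrite /cells /= ifT //; apply/asboolP; exists 0; split => //; exact: sub0mx.
rewrite cons_uniq => /andP[xs us] ff fid gU ck rU.
have fx : f x = x by apply: fid; exact: mem_head.
have fz z : z \in x' :: s -> f z = z.
  by move=> zs; apply: fid; rewrite in_cons zs orbT.
case: k => [|k] in ck rU *.
  rewrite /cells /=; apply/eqP; rewrite size_eq0 -[_ == _]negbK -has_filter.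
  apply/hasPn => t _; apply/asboolP => -[v [vU /andP[/eqP[]]]].
  have /eqP : \rank U = 0 by [].
  rewrite mxrank_eq0 => /eqP U0; move: vU; rewrite U0 submx0 => /eqP ->.
  by rewrite innerE mul0mx mxE.
have sep z : z \in x' :: s ->
    exists2 u, (u <= U)%MS & inner u (y x - y z) != 0.
  move=> zs; apply: (separating_vector gp _ ff gU fx (fz _ zs)).
    by rewrite ck addnS ltnS leq_addr.
  by apply: contraNneq xs => ->.
have -> : edges [:: x, x' & s] =
  [seq (x, z) | z <- x' :: s] ++ edges (x' :: s) by [].
rewrite cells_insert // (IH _ f _ k.+1) //.
rewrite /= -/(chamber_count (size s).+1 _); congr addn.
transitivity (\sum_(z <- x' :: s) chamber_count (size s) k)%N; last first.
  by rewrite big_const_seq count_predT iter_addn_0 mulnC.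
apply: eq_big_seq => z zs.
have xz : x != z by apply: contraNneq xs => ->.
apply: (IH _ (glue f x z) _ k) => //.
- exact: glue_idem (fz _ zs) xz.
- move=> w ws; rewrite /glue fz //; case: eqP => // e.
  by rewrite -e ws in xs.
- exact: glued_glue gU fx (fz _ zs).
- by move: ck; rewrite (card_codom_glue ff fx (fz _ zs) xz) addSn addnS => -[].
- by apply/eqP; rewrite -eqSS -rank_slice ?rU //; exact: sep.
Qed.
End Count.

(** * Stirling numbers *)

Lemma stirling1_coef n k : (0 < n)%N ->
  stirling1 n k = (\prod_(i < n) ('X + i%:R%:P) : {poly nat})`_k.
Proof.
move=> n0; rewrite /stirling1; case: k => [|k] /=.
  case: n n0 => // n _; rewrite big_ord_recl /= addr0 coef0M coefX mul0r //.
case: ltnP => // h.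
rewrite nth_default //; apply: (@leq_trans n.+1) => //.
elim: n {n0 h} => [|n IH]; first by rewrite big_ord0 size_poly1.
rewrite big_ord_recr /=; apply: (leq_trans (size_polyMleq _ _)).
have : (size ('X + n%:R%:P : {poly nat})%R <= 2)%N.
  apply: (leq_trans (size_polyD _ _)); rewrite size_polyX geq_max /=.
  by apply: (leq_trans (size_polyC_leq1 _)).
move: IH; move: (size _) (size _) => a b; lia.
Qed.

Lemma stirling1_rec n k : (0 < n)%N ->
  stirling1 n.+1 k.+1 = (stirling1 n k + n * stirling1 n k.+1)%N.
Proof.
move=> n0; rewrite !stirling1_coef // big_ord_recr /=.
rewrite mulrDr coefD coefMX /= coefMC mulrC.
by congr (_ + _ * _)%N; rewrite natn.
Qed.

(** Stirling numbers indexed by codimension, that is, by the exponent in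
[(1 + t) (1 + 2 t) ... (1 + (n - 1) t)]; the cut-off compensates for the
truncated subtraction. *)
Definition stirling1c n i := if (i <= n)%N then stirling1 n (n - i) else 0%N.

Lemma stirling1cS n i : (0 < n)%N ->
  stirling1c n.+1 i.+1 = (stirling1c n i.+1 + n * stirling1c n i)%N.
Proof.
move=> n0; rewrite /stirling1c ltnS subSS.
case: (ltngtP i n) => [h|h|->]; last by rewrite subnn /stirling1 muln0.
  by rewrite -[(n - i)%N]prednK ?subn_gt0 // stirling1_rec // subnS.
by rewrite muln0.
Qed.

Lemma stirling1c0 n : (0 < n)%N -> stirling1c n 0 = 1%N.
Proof.
rewrite /stirling1c /= subn0; elim: n => // -[|n] IH _.
  by rewrite stirling1_coef // big_ord1 addr0 coefX.
rewrite stirling1_rec // IH // /stirling1 ltnn andbF muln0 //.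
Qed.

(** The sum of [stirling1c n i] over the [i < k] with the parity of
[k.-1]. *)
Fixpoint parity_sum n k : nat :=
  match k with
  | 0 => 0
  | 1 => stirling1c n 0
  | (k'.+1 as k1).+1 => (parity_sum n k' + stirling1c n k1)%N
  end.

(** Two consecutive values of [k] are proved together, since the sums advance
in steps of two. *)
Lemma parity_sumS n k : (0 < n)%N ->
  parity_sum n.+1 k.+1 = (parity_sum n k.+1 + n * parity_sum n k)%N.
Proof.
move=> n0.
suff : parity_sum n.+1 k.+1 = (parity_sum n k.+1 + n * parity_sum n k)%N /\
  parity_sum n.+1 k.+2 = (parity_sum n k.+2 + n * parity_sum n k.+1)%N by case.
elim: k => [|k [IH1 IH2]].
  by rewrite /= !stirling1c0 // !stirling1cS // stirling1c0 // muln0 addn0.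
split => //.
rewrite [LHS]/= -/(parity_sum n.+1 k.+1) IH1 stirling1cS //.
rewrite [parity_sum n k.+3]/= -/(parity_sum n k.+1).
rewrite [parity_sum n k.+2]/=.
lia.
Qed.

(** Both sides satisfy the recurrence of Stirling numbers in codimension. It
starts at two points rather than one, because for a single point the sum on
the right depends on the parity of [k]. *)
Lemma chamber_countE m k : chamber_count m.+1 k = (2 * parity_sum m.+2 k)%N.
Proof.
elim: m k => [|m IH] [|k] //; last first.
  rewrite [LHS]/= -/(chamber_count m.+1 k.+1) -/(chamber_count m.+1 k) !IH.
  by rewrite (@parity_sumS m.+2) //; lia.
rewrite /= mul1n.
suff h k' : (parity_sum 1 k'.+1 + parity_sum 1 k' = 1)%N.
  by rewrite -/(parity_sum 2 k.+1) parity_sumS // mul1n h.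
elim: k' => [|k' IH]; first by rewrite /= stirling1c0.
have c0 : stirling1c 1 k'.+1 = 0%N by case: k' {IH}.
by rewrite [parity_sum 1 k'.+2]/= c0 -[RHS]IH; lia.
Qed.

(** The terms are listed by increasing lower index in [DA], by increasing
codimension in [parity_sum]; passing from [d] to [d.+2] adds the lowest index
and a last term that lies beyond [n]. *)
Lemma DAE n d : (d < n)%N -> DA n d = (2 * parity_sum n d)%N.
Proof.
rewrite /DA => dn; congr muln.
suff : ((d < n)%N ->
      (\sum_(j < d) stirling1 n (n.+1 - d + j.*2))%N = parity_sum n d) /\
    ((d.+1 < n)%N ->
      (\sum_(j < d.+1) stirling1 n (n - d + j.*2))%N = parity_sum n d.+1).
  by case=> h _; exact: h.
elim: d {dn} => [|d [IH1 IH2]].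
  rewrite big_ord0; split=> // n1.
  by rewrite big_ord1 /= /stirling1c subn0 addn0.
split=> [h|dn]; first by rewrite subSS; exact: IH2.
rewrite big_ord_recl big_ord_recr /= addn0 addnC [parity_sum _ _]/=.
rewrite /stirling1c (ltnW (ltnW dn)) -IH1; last lia.
have -> : stirling1 n (n - d.+1 + d.+1.*2) = 0%N.
  by rewrite /stirling1; case: ifP => // /andP[_]; lia.
rewrite /bump /= addn0; congr addn; apply: eq_bigr => i _; congr stirling1.
by rewrite add1n; lia.
Qed.

(** * Cells as connected components *)

Local Open Scope classical_set_scope.
Local Open Scope ring_scope.

Section Topology.
Variables (R : realType) (d : nat).
Implicit Types (L : seq 'rV[R]_d) (v w x : 'rV[R]_d).

Lemma inner_continuous l : continuous (fun v : 'rV[R]_d => inner v l).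
Proof.
rewrite /inner; elim: (index_enum _) => [|i r IH] v.
  by rewrite (_ : (fun _ => _) = fun=> 0);
    [exact: cst_continuous|apply/funext => w; rewrite big_nil].
rewrite (_ : (fun _ => _) = fun w : 'rV[R]_d =>
  w 0 i * l 0 i + \sum_(j <- r) w 0 j * l 0 j).
  have h : {for v, continuous (fun w : 'rV[R]_d => w 0 i * l 0 i)}.
    by apply: (@cvgMr_tmp _ _ (nbhs v)); exact: coord_continuous.
  exact: continuousD h (IH v).
by apply/funext => w; rewrite big_cons.
Qed.

Definition cell L (s : bitseq) : set 'rV[R]_d :=
  [set v | off_walls L v /\ pattern L v = s].

Lemma cell_open L s : open (cell L s).
Proof.
elim: L s => [|l L IH] s.
  case: s => [|b s]; last first.
    rewrite (_ : cell _ _ = set0); first exact: open0.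
    by apply/seteqP; split => v [].
  by rewrite (_ : cell _ _ = setT); [exact: openT|apply/seteqP; split].
case: s => [|b s].
  rewrite (_ : cell _ _ = set0); first exact: open0.
  by apply/seteqP; split => v [].
pose H := if b then [set r : R | 0 < r] else [set r : R | r < 0].
have oH : open H by rewrite /H; case: b {H}; [exact: open_gt|exact: open_lt].
rewrite (_ : cell _ _ = (fun v => inner v l) @^-1` H `&` cell L s).
  apply: openI => //; apply: open_comp => // v _; exact: inner_continuous.
apply/seteqP; split => v; rewrite /cell /H /=.
  move=> [/andP[vl vL] [vb vs]]; split=> //; rewrite -vb; case: ifP => //= h.
  by rewrite lt_neqAle vl leNgt h.
move=> [vb [vL vs]]; rewrite vL vs; case: b vb {H oH} => /= h.
  by rewrite gt_eqF // h.
by rewrite lt_eqF // ltNge ltW.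
Qed.

(** By the intermediate value theorem a connected set off the walls keeps its
signs; and a cell is connected since it contains segments between its
points. *)
Lemma component_cell L x : off_walls L x ->
  connected_component [set v | off_walls L v] x = cell L (pattern L x).
Proof.
move=> xL; apply/seteqP; split.
  move=> v [B [Bx BL cB] Bv]; split; first exact: BL.
  apply/eq_in_map => l lL.
  have /connected_intervalP itv : connected ((fun v => inner v l) @` B).
    apply: connected_continuous_connected => //.
    by apply: continuous_subspaceT => w; apply: inner_continuous.
  have nz w : B w -> inner w l != 0 by move=> /BL /allP /(_ _ lL).
  have cross u w : B u -> B w -> inner u l < 0 -> 0 < inner w l -> False.
    move=> Bu Bw u0 w0; have [z Bz /eqP] := itv (inner u l) (inner w l)
      (imageP _ Bu) (imageP _ Bw) 0 (introT andP (conj (ltW u0) (ltW w0))).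
    by apply/negP; exact: nz.
  have [hv|hv|/eqP] := ltgtP (inner v l) 0; last by rewrite (negbTE (nz _ Bv)).
    apply/esym/negbTE; rewrite -leNgt leNgt; apply/negP => hx.
    exact: (cross v x).
  apply/esym; rewrite lt_neqAle eq_sym nz //= leNgt; apply/negP => hx.
  exact: (cross x v).
move=> v [vL vx].
pose g (t : R) := (1 - t) *: x + t *: v.
exists (g @` `[0, 1]); last first.
  exists 1; last by rewrite /g subrr scale0r add0r scale1r.
  by rewrite /= in_itv /= ler01 lexx.
split.
- exists 0; last by rewrite /g subr0 scale0r addr0 scale1r.
  by rewrite /= in_itv /= ler01 lexx.
- move=> _ [t + <-]; rewrite /= in_itv /= => /andP[t0 t1].
  have [] // := @pattern_cone _ _ L x v (1 - t) t;
    by rewrite ?subr_ge0 ?subrK ?ltr01.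
- apply: connected_continuous_connected; first exact: segment_connected.
  apply: continuous_subspaceT => t; apply: cvgD; apply: cvgZl => //.
  by apply: cvgB => //; exact: cvg_cst.
Qed.

(** Cells are open and disjoint, so a cell that meets the closure of another
one is equal to it. *)
Lemma closure_cell_inj L s t : cell L s !=set0 ->
  closure (cell L s) = closure (cell L t) -> s = t.
Proof.
move=> [x xs] e.
have : closure (cell L t) x by rewrite -e; exact: subset_closure.
move=> /(_ (cell L s)) [|z [[_ <-] [_ <-]] //].
by apply: open_nbhs_nbhs; split => //; exact: cell_open.
Qed.

Lemma card_seq (T : eqType) (s : seq T) : uniq s ->
  ([set x | x \in s] #= `I_(size s))%card.
Proof.
case: s => [|x0 s'] us.
  rewrite (_ : [set x | _] = set0); last by apply/seteqP; split.
  by rewrite II0 card_eq00.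
move: (x0 :: s') us => s us; rewrite card_eq_sym.
have <- : [set nth x0 s i | i in `I_(size s)] = [set x | x \in s].
  apply/seteqP; split => [_ [i /= i_s <-]|x /= xs]; first exact: mem_nth.
  by exists (index x s); rewrite /= ?index_mem ?nth_index.
rewrite card_eq_sym; apply: inj_card_eq => i j /set_mem /= hi /set_mem /= hj.
by move/eqP; rewrite nth_uniq // => /eqP.
Qed.

(** Taking closures loses no cell, so the tessellation is counted by the
realized sign patterns. *)
Lemma card_cells_closure L :
  ([set closure C | C in connected_components [set v | off_walls L v]]
   #= `I_(size (cells 1%:M L)))%card.
Proof.
have -> :
  [set closure C | C in connected_components [set v | off_walls L v]] =
  [set closure (cell L s) | s in [set s | s \in cells 1%:M L]].
  apply/seteqP; split => [_ [_ [x xL <-] <-]|_ [s + <-]].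
    exists (pattern L x); last by rewrite component_cell.
    rewrite /= mem_cells; apply/asboolP; exists x; split => //.
    exact: submx1.
  rewrite /= mem_cells => /asboolP[x [_ xL <-]].
  by exists (cell L (pattern L x)) => //; exists x => //; exact: component_cell.
apply: card_eq_trans (inj_card_eq _) _.
  move=> s t /set_mem /=; rewrite mem_cells => /asboolP[x [_ xL xs]] _.
  by apply: closure_cell_inj; exists x.
exact/card_seq/cells_uniq.
Qed.
End Topology.

(** * The walls of the Weyl tessellation *)

Lemma edges_total (n : nat) (s : seq 'I_n) a b : a \in s -> b \in s -> a != b ->
  ((a, b) \in edges s) || ((b, a) \in edges s).
Proof.
elim: s => //= x s IH; rewrite !in_cons !mem_cat.
move=> /predU1P[->|sa] /predU1P[->|sb]; rewrite ?eqxx // => ab.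
- by rewrite map_f.
- by rewrite map_f ?orbT.
- by have /orP[->|->] := IH sa sb ab; rewrite ?orbT.
Qed.

Lemma edges_neq (n : nat) (s : seq 'I_n) p :
  uniq s -> p \in edges s -> p.1 != p.2.
Proof.
elim: s => //= x s IH /andP[xs us]; rewrite mem_cat.
case/orP=> [/mapP[z zs ->] /=|]; last exact: IH.
by apply: contraNneq xs => ->.
Qed.

Lemma weylA_complementE (R : realType) (n d : nat) (y : 'I_n -> 'rV[R]_d) :
  weylA_complement y = [set v | off_walls (walls y (edges (enum 'I_n))) v].
Proof.
apply/seteqP; split=> v /=.
  move=> hv; apply/allP => _ /mapP[p pE ->]; apply/eqP => v0; apply: hv.
  have := edges_neq (enum_uniq _) pE; rewrite neq_ltn.
  case/orP=> h; [by exists p|exists (p.2, p.1) => //].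
  by rewrite /orth /= -opprB innerNr v0 oppr0.
move=> hv [[a b] /= ab v0].
have /orP[h|h] :
    ((a, b) \in edges (enum 'I_n)) || ((b, a) \in edges (enum 'I_n)).
  by apply: edges_total; rewrite ?mem_enum // -val_eqE ltn_eqF.
- by move/allP/(_ _ (map_f _ h)): hv => /=; rewrite v0 eqxx.
- move/allP/(_ _ (map_f _ h)): hv => /=.
  by rewrite -opprB innerNr v0 oppr0 eqxx.
Qed.

Theorem theorem1p1 (R : realType) (n d : nat) (y : 'I_n -> 'rV[R]_d)
    (hd : (2 <= d)%N) (hy : typeA_general_position y) :
  (weyl_tessellationA y #= `I_(DA n d))%card.
Proof.
have [dn _] := hy.
rewrite /weyl_tessellationA weylA_complementE.
suff -> : DA n d = size (cells 1%:M (walls y (edges (enum 'I_n)))).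
  exact: card_cells_closure.
have : (0 < size (enum 'I_n))%N by rewrite size_enum_ord (leq_trans _ dn).
case En : (enum 'I_n) => [|x s] // _.
have sz : (size s).+1 = n by have := size_enum_ord n; rewrite En.
rewrite (@cells_count _ _ _ _ _ _ id _ d) //; last 4 first.
- by rewrite -En enum_uniq.
- by move=> v; split => // _; exact: submx1.
- by rewrite card_codom // card_ord.
- exact: mxrank1.
move: (size s) sz => m sz; rewrite DAE // -sz; case: m sz => [|m] sz.
  by move: dn; rewrite -sz ltnNge (ltnW hd).
by rewrite chamber_countE.
Qed.
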